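(* Let $k$ be an algebraically closed field, $Q$ a finite acyclic quiver, $A = kQ$, and $B$ an exceptional right $A$-module with dimension vector $\alpha$. Let $Q'$ be a finite acyclic quiver with $Q'_0 = Q_0$ and $Q_1 \subseteq Q'_1$, let $A' = kQ'$ (so $A \subseteq A'$), and set $n = \sum_{e \in Q'_1 \setminus Q_1} \alpha_{s(e)}\alpha_{t(e)}$. Then there exists a universal localisation $f'_B: A' \to M_\alpha(k\langle x_1, \dots, x_n\rangle)$ whose restriction to $A$ equals the universal localisation $f_B: A \to \mathrm{End}_k(B) \cong M_\alpha(k)$ (giving the action of $A$ on $B$, with $\mathrm{End}_k(B)$ identified with $M_\alpha(k)$ via a basis of $B = \bigoplus_v B_v$ adapted to the vertex decomposition) followed by the inclusion $M_\alpha(k) \subseteq M_\alpha(k\langle x_1,\dots,x_n\rangle)$.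
   Context: A right $kQ$-module $B$ is a brick if $\mathrm{End}_{kQ}(B) \cong k$, and exceptional if it is a finite-dimensional brick with $\mathrm{Ext}^1_{kQ}(B,B) = 0$; by a known result, for exceptional $B$ the map $kQ \to \mathrm{End}_k(B)$ is a universal localisation. For a dimension vector $\alpha \in \mathbb{N}_0^{Q_0}$ and a ring $R$, $M_\alpha(R)$ denotes the ring of $N \times N$ matrices over $R$, $N = \sum_{v} \alpha_v$, viewed as block matrices with blocks of size $\alpha_v \times \alpha_w$. $k\langle x_1,\dots,x_n\rangle$ is the free associative $k$-algebra. For a ring $A$ and a set $\Sigma$ of homomorphisms between finitely generated projective right $A$-modules, the universal localisation of $A$ at $\Sigma$ is a ring homomorphism $f_\Sigma: A \to A_\Sigma$ such that $\alpha \otimes_A A_\Sigma$ is an isomorphism for every $\alpha \in \Sigma$, and every ring homomorphism with this property factors uniquely through $f_\Sigma$; a ring homomorphism is a universal localisation if it is, up to isomorphism of the target, of the form $f_\Sigma$. *)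

(* Defs.v *)
From HB Require Import structures.
From mathcomp Require Import all_boot all_order all_algebra.
From mathcomp Require Import finmap.
From mathcomp.multinomials Require Import monalg.
Set Implicit Arguments. Unset Strict Implicit. Unset Printing Implicit Defensive.
Import Order.TTheory GRing.Theory.
Local Open Scope ring_scope.
Local Open Scope fset_scope.

Fixpoint is_path (V E : eqType) (D : pred E) (s t : E -> V) (v u : V) (w : seq E) : bool :=
  if w is a :: w' then [&& a \in D, s a == v & is_path D s t (t a) u w'] else v == u.

Lemma is_path_cat (V E : eqType) (D : pred E) (s t : E -> V) v x u w1 w2 :
  is_path D s t v x w1 -> is_path D s t x u w2 -> is_path D s t v u (w1 ++ w2).
Proof.
elim: w1 v => [|a w1 IH] v /=; first by move=> /eqP ->.
by case/and3P=> -> -> /IH H /H ->.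
Qed.

Definition FreeAlg (k : fieldType) (I : choiceType) := {malg k[{fmonom I}]}.

Section PathAlg.
Variables (k : fieldType) (m : nat) (E : finType) (s t : E -> 'I_m) (D : pred E).

Definition pathpred : pred 'M[FreeAlg k E]_m := fun (M : 'M[FreeAlg k E]_m) =>
  [forall v, forall u, all (fun w : fmonom E => is_path D s t v u w) (msupp (M v u))].

Lemma pathpredP (M : 'M[FreeAlg k E]_m) : reflect (forall v u w, w \in msupp (M v u) -> is_path D s t v u w)
  (pathpred M).
Proof.
apply: (iffP forallP) => [H v u w|H v]; first by move: (forallP (H v) u) => /allP; apply.
by apply/forallP => u; apply/allP => w; apply: H.
Qed.

Lemma pathpred_subring : subring_closed pathpred.
Proof.
split.
- apply/pathpredP => v u w; rewrite mxE.
  case: (v =P u) => [->|_] /=; last by rewrite msupp0.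
  by rewrite msuppU1 inE => /eqP ->; rewrite fm1 /=.
- move=> x y /pathpredP Hx /pathpredP Hy; apply/pathpredP => v u w.
  rewrite !mxE => /(fsubsetP (msuppB_le _ _)); rewrite inE => /orP[].
  + exact: Hx.
  + exact: Hy.
- move=> x y /pathpredP Hx /pathpredP Hy; apply/pathpredP => v u w; rewrite !mxE.
  pose P (g : FreeAlg k E) := forall w, w \in msupp g -> is_path D s t v u w.
  apply: (@big_ind _ P) => //.
  + by move=> w'; rewrite msupp0.
  + move=> g1 g2 H1 H2 w' /(fsubsetP (msuppD_le _ _)); rewrite inE => /orP[].
    * exact: H1.
    * exact: H2.
  + move=> x0 _ w' /msuppM_le [k1 [k2 [h1 h2 ->]]].
    rewrite fmM; apply: is_path_cat; [exact: Hx h1|exact: Hy h2].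
Qed.

HB.instance Definition _ := GRing.isSubringClosed.Build _ pathpred pathpred_subring.

Record pathalg := PathAlg { pa_val :> 'M[FreeAlg k E]_m; pa_valP : pa_val \in pathpred }.
HB.instance Definition _ := [isSub for pa_val].
HB.instance Definition _ := [Choice of pathalg by <:].
HB.instance Definition _ := GRing.SubChoice_isSubPzRing.Build _ _ pathalg pathpred_subring.

Lemma kscal_proof (c : k) : ((c%:MP : FreeAlg k E)%:M : 'M_m) \in pathpred.
Proof.
apply/pathpredP => v u w; rewrite mxE; case: eqP => [->|_]; last by rewrite mulr0n msupp0.
rewrite mulr1n msuppC; case: eqP => _; first by rewrite inE.
by rewrite inE => /eqP ->; rewrite fm1 /=.
Qed.

Definition kscal (c : k) : pathalg := PathAlg (kscal_proof c).

Lemma evtx_proof (v : 'I_m) : (delta_mx v v : 'M[FreeAlg k E]_m) \in pathpred.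
Proof.
apply/pathpredP => x u w; rewrite mxE; case: (x =P v) => [->|_] /=; last by rewrite msupp0.
case: (u =P v) => [->|_] /=; last by rewrite msupp0.
by rewrite msuppU1 inE => /eqP ->; rewrite fm1 /=.
Qed.

Definition evtx (v : 'I_m) : pathalg := PathAlg (evtx_proof v).

Lemma arrow_proof (a : E) : a \in D ->
  (<< fmu a >> *: delta_mx (s a) (t a) : 'M[FreeAlg k E]_m) \in pathpred.
Proof.
move=> aD; apply/pathpredP => x u w; rewrite !mxE.
case: (x =P s a) => [->|_] /=; last by rewrite mulr0 msupp0.
case: (u =P t a) => [->|_] /=; last by rewrite mulr0 msupp0.
by rewrite mulr1 msuppU1 inE => /eqP ->; rewrite fmU /= aD !eqxx.
Qed.

Definition arrow (a : E) (aD : a \in D) : pathalg := PathAlg (arrow_proof aD).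

End PathAlg.

(* the path algebra of the quiver Q = ('I_m, arrows in D, s, t) *)
Arguments pathalg : clear implicits.

Definition acyclic (m : nat) (E : finType) (s t : E -> 'I_m) (D : pred E) : Prop :=
  forall (v : 'I_m) (w : seq E), is_path D s t v v w -> w = [::].

(* the inclusion kQ \subseteq kQ' when Q_1 \subseteq Q'_1 = E *)
Section Incl.
Variables (k : fieldType) (m : nat) (E : finType) (s t : E -> 'I_m) (D : pred E).
Lemma is_path_predT (v u : 'I_m) (w : seq E) : is_path D s t v u w -> is_path predT s t v u w.
Proof. by elim: w v => [|a w IH] v //= /and3P[_ -> /IH ->]. Qed.

Lemma incl_proof (x : pathalg k m E s t D) : pa_val x \in pathpred s t predT.
Proof. by apply/pathpredP => v u w H; apply: is_path_predT; apply: (pathpredP _ _ _ _ (pa_valP x)). Qed.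

Definition incl (x : pathalg k m E s t D) : pathalg k m E s t predT := PathAlg (incl_proof x).
End Incl.

(* Block structure of M_alpha : N x N matrices with N = sum_v alpha_v,     *)
(* index i lies in block v iff pre v <= i < pre v + alpha v.               *)
Definition dimsum (m : nat) (alpha : 'I_m -> nat) : nat := (\sum_(v < m) alpha v)%N.
Definition pre (m : nat) (alpha : 'I_m -> nat) (v : 'I_m) : nat :=
  (\sum_(u < m | (u < v)%N) alpha u)%N.
Definition blockE (R : pzRingType) (m : nat) (alpha : 'I_m -> nat) (v : 'I_m)
  : 'M[R]_(dimsum alpha) :=
  \matrix_(i, j) ((i == j) && (pre alpha v <= i < pre alpha v + alpha v)%N)%:R.

(* Finite-dimensional right kQ-modules with a chosen basis: a right module *)
(* structure on the row space k^N is a k-linear ring morphism              *)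
(* rho : kQ -> M_N(k), acting by b . a = b *m rho a.                        *)
Section Modules.
Variables (k : fieldType) (m : nat) (E : finType) (s t : E -> 'I_m) (D : pred E).
Local Notation A := (pathalg k m E s t D).

Definition klinear (N : nat) (rho : A -> 'M[k]_N) : Prop :=
  forall c : k, rho (@kscal k m E s t D c) = c%:M.

(* the basis is adapted to the vertex decomposition B = (+)_v B e_v, with   *)
(* dim B e_v = alpha v, i.e. rho(e_v) is the v-th block idempotent          *)
Definition adapted (alpha : 'I_m -> nat) (rho : A -> 'M[k]_(dimsum alpha)) : Prop :=
  forall v, rho (@evtx k m E s t D v) = blockE k alpha v.

Definition brick (N : nat) (rho : A -> 'M[k]_N) : Prop :=
  (0 < N)%N /\
  forall phi : 'M[k]_N, (forall a, phi *m rho a = rho a *m phi) -> exists c : k, phi = c%:M.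

(* Ext^1_A(B,B) = 0 : every extension 0 -> B -> X -> B -> 0 of right       *)
(* A-modules splits.  In a basis of X extending one of the submodule B      *)
(* (first N coordinates), the action on X is block lower triangular with   *)
(* diagonal blocks rho; it splits iff the projection X -> B (onto the last  *)
(* N coordinates) has an A-linear section.                                  *)
Definition ext1_vanishes (N : nat) (rho : A -> 'M[k]_N) : Prop :=
  forall rX : {rmorphism A -> 'M[k]_(N + N)},
    klinear rX ->
    (forall a, [/\ ulsubmx (rX a) = rho a, ursubmx (rX a) = 0 & drsubmx (rX a) = rho a]) ->
    exists S : 'M[k]_(N, N + N),
      (forall a, S *m rX a = rho a *m S) /\ S *m col_mx 0 1%:M = 1%:M.

Definition exceptional (N : nat) (rho : A -> 'M[k]_N) : Prop :=
  brick rho /\ ext1_vanishes rho.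
End Modules.

(* Universal localisation.  A homomorphism between finitely generated       *)
(* projective right R-modules is presented as sigma : e' R^n <- e R^m,       *)
(* with e, e' idempotent matrices and sigma = e' sigma e (an n x m matrix   *)
(* acting on columns); every such homomorphism is of this form up to iso.   *)
Record pmap (R : Type) := PMap {
  pm_m : nat; pm_n : nat;
  pm_e : 'M[R]_pm_m; pm_e' : 'M[R]_pm_n; pm_s : 'M[R]_(pm_n, pm_m) }.

Definition valid_pmap (R : pzRingType) (p : pmap R) : Prop :=
  [/\ pm_e p *m pm_e p = pm_e p, pm_e' p *m pm_e' p = pm_e' p
    & pm_s p = pm_e' p *m pm_s p *m pm_e p].

(* f inverts p : sigma (x)_R S : e S^m -> e' S^n is an isomorphism *)
Definition inverts_pmap (R S : pzRingType) (f : R -> S) (p : pmap R) : Prop :=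
  exists tau : 'M[S]_(pm_m p, pm_n p),
    [/\ tau = map_mx f (pm_e p) *m tau *m map_mx f (pm_e' p),
        tau *m map_mx f (pm_s p) = map_mx f (pm_e p)
      & map_mx f (pm_s p) *m tau = map_mx f (pm_e' p)].

Definition inverts (R S : pzRingType) (f : R -> S) (Sigma : pmap R -> Prop) : Prop :=
  forall p, Sigma p -> inverts_pmap f p.

Definition is_univ_loc_at (R T : pzRingType) (f : {rmorphism R -> T})
    (Sigma : pmap R -> Prop) : Prop :=
  inverts f Sigma /\
  forall (S : pzRingType) (g : {rmorphism R -> S}), inverts g Sigma ->
    exists h : {rmorphism T -> S},
      (forall x, g x = h (f x)) /\
      forall h' : {rmorphism T -> S}, (forall x, g x = h' (f x)) -> forall y, h' y = h y.

Definition is_universal_localisation (R T : pzRingType) (f : {rmorphism R -> T}) : Prop :=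
  exists Sigma : pmap R -> Prop,
    (forall p, Sigma p -> valid_pmap p) /\ is_univ_loc_at f Sigma.

(* Main.v *)
Require Import Defs.
From HB Require Import structures.
From mathcomp Require Import all_boot all_order all_algebra.
From mathcomp Require Import finmap.
From mathcomp.multinomials Require Import monalg.
Import GRing.Theory.
Local Open Scope ring_scope.

Set Implicit Arguments.
Unset Strict Implicit.
Unset Printing Implicit Defensive.

(**
Write [T = M_alpha(k)] and let [0 -> P1 -> P0 -> T -> 0] be the standard
resolution of [T] as a right [A]-module.  Lifting [1 : T] to [P0] gives a map
[sigma : P1 (+) A -> P0] of finitely generated projectives.  A morphism
[g : A -> S] inverts [sigma] iff the map [Hom(P0, S) -> Hom(P1, S) (+) S] is
bijective; in particular there is then a unique [A]-linear [h : T -> S] with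
[h 1 = 1], and uniqueness forces [h] to be multiplicative.  For [g = rho] the
map is injective because [End B = k] and surjective because [Ext^1(B, B) = 0].
Hence [rho] is the universal localisation at [sigma].

A morphism [g : A' -> S] inverting [sigma] thus provides matrix units in [S],
images of those of [T], and [S] is a matrix ring over their centraliser.  Each
new arrow [e] is free subject to [e = e_(s e) e e_(t e)], so it contributes the
[alpha_(s e) alpha_(t e)] free entries of its block, which gives the
universal property of [M_alpha(k<x_1, ..., x_n>)].
*)

(** * Bundled morphisms and matrix-unit identities over arbitrary rings *)

Definition rmorphism_pack (R S : pzRingType) (f : R -> S) (fB : zmod_morphism f)
    (fM : monoid_morphism f) : {rmorphism R -> S} :=
  HB.pack f (GRing.isZmodMorphism.Build _ _ f fB) (GRing.isMonoidMorphism.Build _ _ f fM).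

Definition additive_pack (U V : zmodType) (f : U -> V) (fB : zmod_morphism f) : {additive U -> V} :=
  HB.pack f (GRing.isZmodMorphism.Build _ _ f fB).

Lemma big_pair (R : Type) (idx : R) (op : Monoid.com_law idx) (I J : finType) (F : I * J -> R) :
  \big[op/idx]_x F x = \big[op/idx]_i \big[op/idx]_j F (i, j).
Proof. by rewrite pair_bigA; apply: eq_bigr => -[]. Qed.

Lemma mul_scale_delta_mx (R : pzRingType) (n p q : nat) (a b : R)
    (i : 'I_n) (j : 'I_p) (l : 'I_q) :
  (a *: delta_mx i j) *m (b *: delta_mx j l) = (a * b) *: delta_mx i l.
Proof.
apply/matrixP=> x y; rewrite !mxE (bigD1 j) //= big1 => [|z /negPf zj].
  rewrite !mxE !eqxx andbT /= addr0.
  by case: (x == _); case: (y == _); rewrite /= ?mulr1 ?mulr0 ?mul0r.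
by rewrite !mxE zj andbF mulr0 mul0r.
Qed.

Lemma scalar_mx_central (R : pzRingType) (n : nat) (c : R) (M : 'M[R]_n) :
  (forall x, c * x = x * c) -> c%:M *m M = M *m c%:M.
Proof.
move=> cC; rewrite mul_scalar_mx -diag_const_mx mul_mx_diag.
by apply/matrixP=> i j; rewrite !mxE.
Qed.

Lemma mul_delta_mxE (R : comNzRingType) (n p q : nat) (l : 'I_q) (i : 'I_n) (M : 'M[R]_(n, p)) :
  delta_mx l i *m M = \sum_j M i j *: delta_mx l j.
Proof.
apply/matrixP=> u v; rewrite !mxE summxE.
rewrite (bigD1 i) //= big1 ?addr0 => [|w /negPf wi]; last by rewrite !mxE wi andbF mul0r.
rewrite (bigD1 v) //= big1 ?addr0 => [|w /negPf wv]; last first.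
  by rewrite !mxE [v == w]eq_sym wv andbF mulr0.
by rewrite !mxE !eqxx !andbT mulrC.
Qed.

Lemma delta_mx_sandwich (R : pzRingType) (n p q r : nat) (M : 'M[R]_(p, q))
    (a : 'I_n) (i : 'I_p) (j : 'I_q) (b : 'I_r) :
  delta_mx a i *m M *m delta_mx j b = M i j *: delta_mx a b.
Proof.
apply/matrixP=> x y; rewrite !mxE (bigD1 j) //= big1 ?addr0 => [|z /negPf zj]; last first.
  by rewrite [delta_mx j b z y]mxE zj mulr0.
rewrite !mxE (bigD1 i) //= big1 ?addr0 => [|z /negPf zi]; last by rewrite mxE zi andbF mul0r.
rewrite !mxE !eqxx andbT /=.
by case: (x == a); case: (y == b); rewrite ?mul1r ?mul0r ?mulr1 ?mulr0.
Qed.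

Lemma scale_delta_mxE (R : pzRingType) (n p : nat) (x : R) (a i : 'I_n) (b j : 'I_p) :
  (x *: delta_mx a b) i j = if (i == a) && (j == b) then x else 0.
Proof. by rewrite !mxE; case: (_ && _); rewrite ?mulr1 ?mulr0. Qed.

Lemma mul_diag_scale_delta (R : pzRingType) (n p : nat) (P : pred 'I_n) (x : R)
    (a : 'I_n) (b : 'I_p) : P a ->
  diag_mx (\row_i (P i)%:R) *m (x *: delta_mx a b) = x *: delta_mx a b.
Proof.
move=> Pa; rewrite mul_diag_mx; apply/matrixP=> i j; rewrite mxE scale_delta_mxE mxE.
by have [->|_] := eqVneq i a; rewrite ?Pa ?mul1r ?mulr0.
Qed.

Lemma mul_scale_delta_diag (R : pzRingType) (n p : nat) (P : pred 'I_p) (x : R)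
    (a : 'I_n) (b : 'I_p) : P b ->
  (x *: delta_mx a b) *m diag_mx (\row_j (P j)%:R) = x *: delta_mx a b.
Proof.
move=> Pb; rewrite mul_mx_diag; apply/matrixP=> i j; rewrite mxE scale_delta_mxE mxE.
by have [->|_] := eqVneq j b; rewrite ?Pb ?mulr1 ?andbF ?mul0r.
Qed.

(** * The free algebra: generation and universal property *)

Section FreeAlgebra.
Variables (k : fieldType) (I : choiceType).

Lemma malgC_mulU (c d : k) (w : {fmonom I}) :
  (c%:MP : FreeAlg k I) * << d *g w >> = << c * d *g w >>.
Proof. by rewrite mul_malgC; apply/malgP=> w'; rewrite mcoeffZ !mcoeffU mulrnAr. Qed.

Lemma malg_consU (i : I) (w : seq I) :
  (<< fmu i >> : FreeAlg k I) * << FMonom w >> = << FMonom (i :: w) >>.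
Proof.
rewrite malgME !msuppU1 !big_seq_fset1 !mcoeffUU mulr1.
by congr << 1 *g _ >>; apply: val_inj; rewrite /= fmM fmU.
Qed.

Lemma FreeAlg_ind (P : FreeAlg k I -> Prop) :
  (forall x y, P x -> P y -> P (x + y)) -> (forall x y, P x -> P y -> P (x * y)) ->
  (forall c : k, P c%:MP) -> (forall i, P << fmu i >>) -> forall x, P x.
Proof.
move=> PD PM PC PU x; rewrite [x]monalgE.
apply: (big_ind P) => // [|w _].
  by have := PC 0; rewrite malgC0E.
rewrite -[x@_w]mulr1 -malgC_mulU; apply: (PM) => //.
case: w => w; elim: w => [|i w IH]; last by rewrite -malg_consU; apply: (PM).
have -> : FMonom [::] = mone :> {fmonom I} by apply: val_inj; rewrite /= fm1.
exact: PC.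
Qed.

Lemma malgC_comm (c : k) (g : FreeAlg k I) : c%:MP * g = g * c%:MP.
Proof.
elim/FreeAlg_ind: g => [x y ex ey|x y ex ey|d|i].
- by rewrite mulrDr mulrDl ex ey.
- by rewrite mulrA ex -mulrA ey mulrA.
- by rewrite -!mpolyCM mulrC.
rewrite malgC_mulU malgME msuppU1 big_seq_fset1.
rewrite (big_fset_incl _ (@msuppU_le _ _ _ _)) => [|w _ /mcoeff_outdom ->].
  by rewrite big_seq_fset1 !mcoeffUU mul1r mulm1 mulr1.
by rewrite mulr0 monalgU0.
Qed.

(** The test rings of a universal localisation are arbitrary, so [R] is not assumed to be a
    [k]-algebra: it suffices that the image of [k] commutes with the chosen images of the variables,
    since scalars can then be moved past words. *)
Lemma FreeAlg_lift (R : pzRingType) (c : {rmorphism k -> R}) (phi : I -> R) :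
  (forall x i, GRing.comm (c x) (phi i)) ->
  exists F : {rmorphism FreeAlg k I -> R},
    (forall x, F x%:MP = c x) /\ (forall i, F << fmu i >> = phi i).
Proof.
move=> cphi.
pose word (w : {fmonom I}) : R := \prod_(i <- w) phi i.
pose F (g : FreeAlg k I) : R := \sum_(w <- msupp g) c g@_w * word w.
have cword x w : GRing.comm (c x) (word w).
  by rewrite /word; elim/big_rec: _ => [|i y _ IH]; [exact: commr1|exact: commrM].
have FEw (d : {fset {fmonom I}}) g : (msupp g `<=` d)%fset -> F g = \sum_(w <- d) c g@_w * word w.
  move=> le; rewrite [LHS](big_fset_incl _ le) => //= x xd /mcoeff_outdom ->.
  by rewrite rmorph0 mul0r.
have FU x w : F << x *g w >> = c x * word w.
  by rewrite (FEw _ _ msuppU_le) big_seq_fset1 mcoeffUU.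
have Fzmod : zmod_morphism F.
  move=> g1 g2; rewrite !(FEw (msupp g1 `|` msupp g2)%fset) ?fsubsetUl ?fsubsetUr ?msuppB_le //.
  by rewrite -sumrB; apply: eq_bigr => w _; rewrite mcoeffB rmorphB mulrBl.
pose Fa : {additive FreeAlg k I -> R} := HB.pack F (GRing.isZmodMorphism.Build _ _ F Fzmod).
have Fsum (r : seq {fmonom I}) G : F (\sum_(w <- r) G w) = \sum_(w <- r) F (G w).
  exact: (raddf_sum Fa).
have FC x : F x%:MP = c x by rewrite FU /word fm1 big_nil mulr1.
have Fmon : monoid_morphism F.
  split=> [|g1 g2]; first by rewrite FC rmorph1.
  rewrite malgME Fsum mulr_suml; apply: eq_bigr => i _.
  rewrite Fsum mulr_sumr; apply: eq_bigr => j _.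
  rewrite FU rmorphM {1}/word fmM big_cat /= -/(word i) -/(word j) -!mulrA.
  by congr (_ * _); rewrite mulrA cword -mulrA.
exists (rmorphism_pack Fzmod Fmon).
by split=> // i /=; rewrite FU rmorph1 mul1r /word fmU big_seq1.
Qed.

End FreeAlgebra.

(** * The path algebra: generators and universal property *)

Section PathAlgebra.
Variables (k : fieldType) (m : nat) (E : finType) (s t : E -> 'I_m) (D : pred E).
Local Notation A := (pathalg k m E s t D).

Lemma pa_valD : {morph @pa_val k m E s t D : x y / x + y}.
Proof. exact: (raddfD val). Qed.

Lemma pa_valM : {morph @pa_val k m E s t D : x y / x * y}.
Proof. exact: (rmorphM val). Qed.

Lemma pa_val1 : pa_val (1 : A) = 1.
Proof. exact: (rmorph1 val). Qed.

Lemma pa_val0 : pa_val (0 : A) = 0.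
Proof. exact: (raddf0 val). Qed.

Lemma pa_valN : {morph @pa_val k m E s t D : x / - x}.
Proof. exact: (raddfN val). Qed.

Lemma pa_val_inj : injective (@pa_val k m E s t D).
Proof. exact: val_inj. Qed.

Lemma kscal_zmod_morphism : zmod_morphism (@kscal k m E s t D).
Proof.
by move=> x y; apply: pa_val_inj; rewrite pa_valD pa_valN /= !raddfB.
Qed.

Lemma kscal_monoid_morphism : monoid_morphism (@kscal k m E s t D).
Proof.
split=> [|x y]; apply: pa_val_inj; first by rewrite pa_val1.
by rewrite pa_valM /= mpolyCM scalar_mxM.
Qed.

HB.instance Definition _ :=
  GRing.isZmodMorphism.Build k A (@kscal k m E s t D) kscal_zmod_morphism.
HB.instance Definition _ :=
  GRing.isMonoidMorphism.Build k A (@kscal k m E s t D) kscal_monoid_morphism.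

Lemma kscal_comm (c : k) (x : A) : kscal s t D c * x = x * kscal s t D c.
Proof.
apply: pa_val_inj; rewrite !pa_valM -!mulmxE.
exact/scalar_mx_central/malgC_comm.
Qed.

Lemma evtx_mul (v u : 'I_m) :
  evtx k s t D v * evtx k s t D u = if v == u then evtx k s t D v else 0.
Proof.
apply: pa_val_inj; rewrite pa_valM /= -mulmxE mul_delta_mx_cond.
by case: eqP => [->|_]; rewrite ?pa_val0.
Qed.

Lemma evtx_sum : \sum_v evtx k s t D v = 1.
Proof.
apply: pa_val_inj; rewrite pa_val1 (big_morph _ pa_valD pa_val0) /=.
apply/matrixP=> i j; rewrite summxE !mxE (bigD1 i) //= big1 => [|u /negPf ui].
  by rewrite mxE eqxx addr0 eq_sym.
by rewrite mxE eq_sym ui.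
Qed.

Lemma evtx_arrow (a : E) (aD : a \in D) : evtx k s t D (s a) * arrow k s t aD = arrow k s t aD.
Proof.
apply: pa_val_inj; rewrite pa_valM /= -mulmxE.
by rewrite -[delta_mx (s a) (s a)]scale1r mul_scale_delta_mx mul1r.
Qed.

Lemma arrow_evtx (a : E) (aD : a \in D) : arrow k s t aD * evtx k s t D (t a) = arrow k s t aD.
Proof.
by apply: pa_val_inj; rewrite pa_valM /= -mulmxE -scalemxAl mul_delta_mx.
Qed.

(** Split a matrix into entries and each entry into monomials. A monomial in position [(v, u)] is a
    path, hence a scalar times a product of arrows ending in the idempotent at [u]. *)
Lemma pathalg_ind (P : A -> Prop) :
  (forall x y, P x -> P y -> P (x + y)) -> (forall x y, P x -> P y -> P (x * y)) ->
  (forall c, P (kscal s t D c)) -> (forall v, P (evtx k s t D v)) ->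
  (forall a (aD : a \in D), P (arrow k s t aD)) -> forall x, P x.
Proof.
move=> PD PM PC PV PA x.
(* [Q] carries [P] over to bare matrices, so that the pieces of the decomposition need no separate
   proof of membership in the path algebra. *)
pose Q (M : 'M[FreeAlg k E]_m) := exists2 y : A, P y & pa_val y = M.
suff [y Py /pa_val_inj <-] : Q (pa_val x) by [].
have Q0 : Q 0 by exists (kscal s t D 0) => //=; rewrite malgC0E raddf0.
have QD M1 M2 : Q M1 -> Q M2 -> Q (M1 + M2).
  by move=> [y1 P1 <-] [y2 P2 <-]; exists (y1 + y2); [exact: PD|rewrite pa_valD].
have QM M1 M2 : Q M1 -> Q M2 -> Q (M1 * M2).
  by move=> [y1 P1 <-] [y2 P2 <-]; exists (y1 * y2); [exact: PM|rewrite pa_valM].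
rewrite [pa_val x]matrix_sum_delta.
apply: (big_ind Q) => // v _; apply: (big_ind Q) => // u _.
rewrite {1}[pa_val x v u]monalgE scaler_suml big_seq.
apply: (big_ind Q) => // w /(pathpredP _ _ _ _ (pa_valP x)).
rewrite -[_@_w]mulr1 -malgC_mulU -scalerA -mul_scalar_mx => wP.
apply: (QM); first by exists (kscal s t D (pa_val x v u)@_w).
case: w wP => w /=; elim: w v => [|a w IH] v /=.
  move/eqP<-; exists (evtx k s t D v) => //=.
  have -> : FMonom [::] = mone :> {fmonom E} by apply: val_inj; rewrite /= fm1.
  by rewrite scale1r.
case/and3P=> aD /eqP <- /IH Qw; rewrite -malg_consU.
suff -> : (<< fmu a >> * << FMonom w >>) *: delta_mx (s a) u =
  (<< fmu a >> *: delta_mx (s a) (t a)) * (<< FMonom w >> *: delta_mx (t a) u) :> 'M[FreeAlg k E]_m.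
  by apply: (QM) Qw; exists (arrow k s t aD); first exact: PA.
by rewrite -mulmxE mul_scale_delta_mx.
Qed.

Lemma eq_pathalg_morphism (R : pzRingType) (f g : {rmorphism A -> R}) :
  (forall c, f (kscal s t D c) = g (kscal s t D c)) ->
  (forall v, f (evtx k s t D v) = g (evtx k s t D v)) ->
  (forall a (aD : a \in D), f (arrow k s t aD) = g (arrow k s t aD)) -> f =1 g.
Proof.
move=> eC eV eA; apply: pathalg_ind => // x y ex ey.
  by rewrite !rmorphD ex ey.
by rewrite !rmorphM ex ey.
Qed.

(** The arrows are first extended to the whole free algebra by some [F]; a matrix [x] is then sent
    to the sum of the [eps v * F (x v u) * eps u]. *)
Lemma pathalg_lift (R : pzRingType) (c : {rmorphism k -> R}) (eps : 'I_m -> R) (phi : E -> R) :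
  (forall x v, GRing.comm (c x) (eps v)) -> (forall x a, GRing.comm (c x) (phi a)) ->
  (forall v u, eps v * eps u = if v == u then eps v else 0) -> \sum_v eps v = 1 ->
  (forall a, a \in D -> eps (s a) * phi a = phi a /\ phi a * eps (t a) = phi a) ->
  exists f : {rmorphism A -> R},
    [/\ forall x, f (kscal s t D x) = c x, forall v, f (evtx k s t D v) = eps v
      & forall a (aD : a \in D), f (arrow k s t aD) = phi a].
Proof.
move=> ceps cphi epsM eps1 epsphi.
have [F [FC FU]] := FreeAlg_lift cphi.
(* Along a path from [v] to [u] the final idempotent is absorbed. This removes the idempotent
   between two factors and makes the map below multiplicative. *)
have FM (v u : 'I_m) (g : FreeAlg k E) :
    (forall w : {fmonom E}, w \in msupp g -> is_path D s t v u w) ->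
    eps v * F g * eps u = eps v * F g.
  move=> gP; rewrite [g]monalgE rmorph_sum mulr_sumr mulr_suml big_seq [RHS]big_seq.
  apply: eq_bigr => w /gP; rewrite -[g@_w]mulr1 -malgC_mulU rmorphM FC.
  rewrite !mulrA -ceps -!mulrA => wP; congr (_ * _); rewrite mulrA.
  case: w wP => w /=; elim: w v {gP} => [|a w IH] v /=.
    move/eqP<-; have -> : FMonom [::] = mone :> {fmonom E} by apply: val_inj; rewrite /= fm1.
    by rewrite rmorph1 mulr1 epsM eqxx.
  case/and3P=> aD /eqP <- /IH Fw; rewrite -malg_consU rmorphM FU.
  have [e1 e2] := epsphi a aD; rewrite [eps (s a) * _]mulrA e1 -e2.
  by move: Fw; rewrite -!mulrA => ->.
pose f (x : A) : R := \sum_v \sum_u eps v * F (pa_val x v u) * eps u.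
have fzmod : zmod_morphism f.
  move=> x y; rewrite /f -sumrB; apply: eq_bigr => v _; rewrite -sumrB; apply: eq_bigr => u _.
  by rewrite pa_valD pa_valN !mxE rmorphB mulrBr mulrBl.
have fC x : f (kscal s t D x) = c x.
  rewrite /f -[RHS]mulr1 -eps1 mulr_sumr; apply: eq_bigr => v _.
  rewrite (bigD1 v) //= big1 => [|u /negPf uv]; last by rewrite mxE eq_sym uv rmorph0 mulr0 mul0r.
  by rewrite mxE eqxx FC -ceps -mulrA epsM eqxx addr0.
have fmon : monoid_morphism f.
  split=> [|x y]; first by rewrite -(rmorph1 (kscal s t D)) fC rmorph1.
  rewrite /f mulr_suml; apply: eq_bigr => v _.
  rewrite mulr_suml; under eq_bigr do rewrite pa_valM mxE rmorph_sum mulr_sumr mulr_suml.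
  rewrite exchange_big /=; apply: eq_bigr => l _.
  rewrite mulr_sumr [RHS](bigD1 l) //= [X in _ + X]big1 ?addr0 => [|l' /negPf ll]; last first.
    rewrite mulr_sumr big1 // => u _.
    by rewrite -!mulrA [eps l * _]mulrA epsM eq_sym ll mul0r !mulr0.
  rewrite mulr_sumr; apply: eq_bigr => u _.
  rewrite rmorphM !mulrA -[_ * eps l * eps l]mulrA epsM eqxx FM //.
  by move=> w; apply: (pathpredP _ _ _ _ (pa_valP x)).
exists (rmorphism_pack fzmod fmon).
split=> //= [v|a aD].
  rewrite /f (bigD1 v) //= (bigD1 v) //= !mxE !eqxx rmorph1 mulr1 epsM eqxx.
  rewrite !big1 ?addr0 // => [u /negPf uv|u /negPf uv].
    by rewrite big1 // => l _; rewrite mxE uv rmorph0 mulr0 mul0r.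
  by rewrite mxE uv andbF rmorph0 mulr0 mul0r.
rewrite /f (bigD1 (s a)) //= (bigD1 (t a)) //= !mxE !eqxx mulr1 FU.
have [-> ->] := epsphi a aD.
rewrite !big1 ?addr0 // => [u /negPf uv|u /negPf uv].
  by rewrite big1 // => l _; rewrite !mxE uv mulr0 rmorph0 mulr0 mul0r.
by rewrite !mxE uv andbF mulr0 rmorph0 mulr0 mul0r.
Qed.

End PathAlgebra.

(** * Invertibility of a map of projectives, tested on row vectors *)

Section RowCriterion.
Variables (R S : pzRingType) (f : {rmorphism R -> S}) (p : Defs.pmap R).
Hypothesis pV : valid_pmap p.
Local Notation e := (map_mx f (pm_e p)).
Local Notation e' := (map_mx f (pm_e' p)).
Local Notation sg := (map_mx f (pm_s p)).

(** This is the map induced on [Hom(-, S)]. An inverse is assembled from preimages of the rows of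
    [e]; injectivity then forces it to be two-sided. *)
Lemma inverts_pmap_rowP :
  inverts_pmap f p <->
  (forall z : 'rV[S]_(pm_m p), z *m e = z -> exists2 y : 'rV[S]_(pm_n p), y *m e' = y & y *m sg = z)
  /\ (forall y : 'rV[S]_(pm_n p), y *m e' = y -> y *m sg = 0 -> y = 0).
Proof.
case: pV => ee e'e' se.
have {}ee : e *m e = e by rewrite -map_mxM ee.
have {}e'e' : e' *m e' = e' by rewrite -map_mxM e'e'.
have {}se : sg = e' *m sg *m e by rewrite -!map_mxM -se.
have sge : sg *m e = sg by rewrite se -mulmxA ee.
have e'sg : e' *m sg = sg by rewrite {1}se !mulmxA e'e' -se.
split=> [[tau [tauE taus stau]]|[surj inj]].
  have te' : tau *m e' = tau by rewrite tauE -mulmxA e'e'.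
  split=> [z ze|y ye ys]; first by exists (z *m tau); rewrite -mulmxA ?te' ?taus.
  by rewrite -ye -stau mulmxA ys mul0mx.
have inj' q (Y : 'M[S]_(q, pm_n p)) : Y *m e' = Y -> Y *m sg = 0 -> Y = 0.
  move=> YE Ys; apply/row_matrixP => i; rewrite row0; apply: inj.
    by rewrite -row_mul YE.
  by rewrite -row_mul Ys row0.
have ex_row i : exists y : 'rV[S]_(pm_n p), y *m e' = y /\ y *m sg = row i e.
  by have [|y yE ys] := surj (row i e); [rewrite -row_mul ee|exists y].
have [Y YP] := fin_all_exists ex_row.
pose tau := \matrix_i Y i.
have te' : tau *m e' = tau.
  by apply/row_matrixP=> i; rewrite row_mul rowK; case: (YP i).
have ts : tau *m sg = e.
  by apply/row_matrixP=> i; rewrite row_mul rowK; case: (YP i).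
exists tau; split=> //.
  rewrite -mulmxA te'; apply/eqP; rewrite -subr_eq0; apply/eqP; apply: inj'.
    by rewrite mulmxBl -mulmxA te'.
  by rewrite mulmxBl -mulmxA ts ee subrr.
apply/eqP; rewrite -subr_eq0; apply/eqP; apply: inj'.
  by rewrite mulmxBl -mulmxA te' e'e'.
by rewrite mulmxBl -mulmxA ts sge e'sg subrr.
Qed.

End RowCriterion.

(** * Maps between finite sums of modules generated by idempotents *)

Section DiagonalMaps.
Variables (R : pzRingType) (I J : finType) (d' : I -> R) (d : J -> R) (sg : I -> J -> R).

(* the map (+)_j d_j R -> (+)_i d'_i R with matrix sg *)
Definition diag_pmap : Defs.pmap R :=
  @PMap R #|J| #|I| (diag_mx (\row_j d (enum_val j))) (diag_mx (\row_i d' (enum_val i)))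
    (\matrix_(i, j) sg (enum_val i) (enum_val j)).

Hypothesis dd : forall j, d j * d j = d j.
Hypothesis d'd' : forall i, d' i * d' i = d' i.
Hypothesis dsd : forall i j, d' i * sg i j * d j = sg i j.

Lemma diag_pmap_valid : valid_pmap diag_pmap.
Proof.
split=> /=; rewrite mul_diag_mx ?mul_mx_diag; apply/matrixP=> i j; rewrite !mxE ?dsd //.
  by case: eqP => [->|_]; rewrite ?mulr1n ?dd ?mulr0n ?mulr0.
by case: eqP => [->|_]; rewrite ?mulr1n ?d'd' ?mulr0n ?mulr0.
Qed.

Lemma inverts_diag_pmapP (S : pzRingType) (f : {rmorphism R -> S}) :
  inverts_pmap f diag_pmap <->
  (forall z : J -> S, (forall j, z j * f (d j) = z j) ->
     exists2 y : I -> S, (forall i, y i * f (d' i) = y i)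
       & (forall j, \sum_i y i * f (sg i j) = z j))
  /\ (forall y : I -> S, (forall i, y i * f (d' i) = y i) ->
        (forall j, \sum_i y i * f (sg i j) = 0) -> forall i, y i = 0).
Proof.
have map_diag (K : finType) (b : K -> R) :
    map_mx f (diag_mx (\row_i b (enum_val i))) = diag_mx (\row_i f (b (enum_val i))).
  by rewrite map_diag_mx; congr diag_mx; apply/rowP=> i; rewrite !mxE.
pose rowof (K : finType) (y : K -> S) : 'rV[S]_#|K| := \row_i y (enum_val i).
have rowofK (K : finType) (y : 'rV[S]_#|K|) : rowof K (fun i => y 0 (enum_rank i)) = y.
  by apply/rowP=> i; rewrite mxE enum_valK.
have rowof_inj (K : finType) (y y' : K -> S) : rowof K y = rowof K y' <-> y =1 y'.
  split=> [/rowP yy i|yy]; last by apply/rowP=> i; rewrite !mxE yy.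
  by have := yy (enum_rank i); rewrite !mxE enum_rankK.
have rowof_diag (K : finType) (b : K -> R) (y : K -> S) :
    rowof K y *m map_mx f (diag_mx (\row_i b (enum_val i))) = rowof K (fun i => y i * f (b i)).
  by rewrite map_diag mul_mx_diag; apply/rowP=> i; rewrite !mxE.
have rowof_sg (y : I -> S) :
    rowof I y *m map_mx f (pm_s diag_pmap) = rowof J (fun j => \sum_i y i * f (sg i j)).
  apply/rowP=> j; rewrite !mxE [RHS](reindex _ (onW_bij _ (enum_val_bij I))) /=.
  by apply: eq_bigr => i _; rewrite !mxE.
have H := inverts_pmap_rowP f diag_pmap_valid.
rewrite {}H; split=> [[surj inj]|[surj inj]].
  split=> [z zd|y yd ys].
    have [|y yE ys] := surj (rowof J z); first by rewrite rowof_diag; apply/rowof_inj.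
    exists (fun i => y 0 (enum_rank i)); apply/rowof_inj.
      by rewrite -rowof_diag rowofK.
    by rewrite -rowof_sg rowofK.
  apply/(rowof_inj _ y (fun=> 0)); rewrite -[RHS]/(rowof I (fun=> 0)).
  have -> : rowof I (fun=> 0) = 0 by apply/rowP=> i; rewrite !mxE.
  apply: inj; first by rewrite rowof_diag; apply/rowof_inj.
  by rewrite rowof_sg; apply/rowP=> j; rewrite !mxE ys.
split=> [z|y]; rewrite -[X in X *m _]rowofK rowof_diag -[X in _ = X]rowofK => /rowof_inj.
  move=> /surj[y yd ys]; exists (rowof I y); first by rewrite rowof_diag; apply/rowof_inj.
  by rewrite rowof_sg -[RHS]rowofK; apply/rowof_inj.
move=> /inj y0; rewrite -[y]rowofK rowof_sg => ys.
apply/rowP=> i; rewrite !mxE y0 // => j.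
by have /rowP/(_ (enum_rank j)) := ys; rewrite !mxE enum_rankK.
Qed.

End DiagonalMaps.

(** * Composition and base change of inverted maps *)

Lemma inverts_pmap_comp (R S U : pzRingType) (f : {rmorphism R -> S}) (h : {rmorphism S -> U})
    (p : Defs.pmap R) : inverts_pmap f p -> inverts_pmap (fun x => h (f x)) p.
Proof.
case=> tau [tE ts st]; exists (map_mx h tau).
have mapc n q (M : 'M[R]_(n, q)) : map_mx (fun x => h (f x)) M = map_mx h (map_mx f M).
  by rewrite -map_mx_comp.
by rewrite !mapc -!map_mxM -tE ts st.
Qed.

Definition map_pmap (R S : Type) (f : R -> S) (p : Defs.pmap R) : Defs.pmap S :=
  PMap (map_mx f (pm_e p)) (map_mx f (pm_e' p)) (map_mx f (pm_s p)).

Lemma map_pmap_valid (R S : pzRingType) (f : {rmorphism R -> S}) (p : Defs.pmap R) :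
  valid_pmap p -> valid_pmap (map_pmap f p).
Proof. by case=> e1 e2 e3; split; rewrite /= -!map_mxM ?e1 ?e2 -?e3. Qed.

Lemma inverts_map_pmap (R S U : pzRingType) (f : R -> S) (g : S -> U) (p : Defs.pmap R) :
  inverts_pmap g (map_pmap f p) <-> inverts_pmap (fun x => g (f x)) p.
Proof. by rewrite /inverts_pmap /= -!map_mx_comp. Qed.

Lemma eq_inverts_pmap (R S : pzRingType) (f g : R -> S) (p : Defs.pmap R) :
  f =1 g -> inverts_pmap f p -> inverts_pmap g p.
Proof.
move=> fg [tau [t1 t2 t3]]; exists tau.
by rewrite -!(eq_map_mx _ fg).
Qed.

(** * The standard resolution and the localisation [rho] *)

Section Resolution.
Variables (k : fieldType) (m : nat) (E : finType) (s t : E -> 'I_m) (D : pred E) (N : nat).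
Local Notation A := (pathalg k m E s t D).
Variables (rho : {rmorphism A -> 'M[k]_N}) (vb : 'I_N -> 'I_m).
Hypothesis rhoC : klinear rho.
Hypothesis rhoV : forall v, rho (evtx k s t D v) = diag_mx (\row_i (vb i == v)%:R).

Local Notation ksc := (kscal s t D).
Local Notation evt := (evtx k s t D).

(** Extending by zero outside [D] lets families be indexed by all of [E], without membership
    proofs. *)
Definition arr (a : E) : A := if @idP (a \in D) is ReflectT aD then arrow k s t aD else 0.

Lemma arrE (a : E) (aD : a \in D) : arr a = arrow k s t aD.
Proof.
rewrite /arr; case: {-}_ / idP => [aD'|//].
by congr arrow; apply: bool_irrelevance.
Qed.

Lemma arr_notin (a : E) : a \notin D -> arr a = 0.
Proof. by move=> aD; rewrite /arr; case: {-}_ / idP => // aD'; rewrite aD' in aD. Qed.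

Lemma evt_arr (a : E) : evt (s a) * arr a = arr a.
Proof.
have [aD|/arr_notin->] := boolP (a \in D); last by rewrite mulr0.
by rewrite (arrE aD) evtx_arrow.
Qed.

Lemma arr_evt (a : E) : arr a * evt (t a) = arr a.
Proof.
have [aD|/arr_notin->] := boolP (a \in D); last by rewrite mul0r.
by rewrite (arrE aD) arrow_evtx.
Qed.

Lemma rho_arr_source (a : E) i j : (vb i == s a)%:R * rho (arr a) i j = rho (arr a) i j.
Proof. by rewrite -[in RHS]evt_arr rmorphM /= rhoV -mulmxE mul_diag_mx !mxE. Qed.

Lemma rho_arr_target (a : E) i j : rho (arr a) i j * (vb j == t a)%:R = rho (arr a) i j.
Proof. by rewrite -[in RHS]arr_evt rmorphM /= rhoV -mulmxE mul_mx_diag !mxE. Qed.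

Definition arrow_at (a : E) (i : 'I_N) := (a \in D) && (vb i == s a).

Lemma rho_arr_notat (a : E) i j : ~~ arrow_at a i -> rho (arr a) i j = 0.
Proof.
rewrite negb_and => /orP[/arr_notin->|/negPf vi]; first by rewrite rmorph0 mxE.
by rewrite -rho_arr_source vi mul0r.
Qed.

(* The basis of the projective [P0 = (+)_v T e_v (x) e_v A] is indexed by the
   matrix units of [T = 'M_N]; [Some (l, i, a)] indexes the generator
   [E_li (x) e_(t a)] of [P1], and [None] the free summand [A]. *)
Definition res_row (x : 'I_N * 'I_N) : A := evt (vb x.2).

Definition res_col (c : option ('I_N * 'I_N * E)) : A :=
  if c is Some (l, i, a) then if arrow_at a i then evt (t a) else 0 else 1.

(** Column [Some (l, i, a)] is the differential [E_li a (x) e_(t a) - E_li (x) a] in coordinates;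
    column [None] is the lift of [1], the sum of the [E_ll (x) e_(vb l)]. If [a] is not an arrow of
    [D] starting at [vb i], the column is zero, and so is its summand. *)
Definition res_mx (x : 'I_N * 'I_N) (c : option ('I_N * 'I_N * E)) : A :=
  if c is Some (l, i, a) then
    if arrow_at a i && (x.1 == l) then
      ksc (rho (arr a) i x.2) * evt (t a) - (if i == x.2 then arr a else 0)
    else 0
  else if x.1 == x.2 then evt (vb x.2) else 0.

Definition res_pmap := diag_pmap res_row res_col res_mx.

Lemma evt_idem v : evt v * evt v = evt v.
Proof. by rewrite evtx_mul eqxx. Qed.

Lemma res_row_idem x : res_row x * res_row x = res_row x.
Proof. exact: evt_idem. Qed.

Lemma res_col_idem c : res_col c * res_col c = res_col c.
Proof.
case: c => [[[l i] a]|] /=; last by rewrite mulr1.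
by case: ifP; rewrite ?evt_idem ?mulr0.
Qed.

Lemma ksc_rho_target a i j : evt (vb j) * ksc (rho (arr a) i j) = evt (t a) * ksc (rho (arr a) i j).
Proof.
rewrite -rho_arr_target; case: eqP => [->//|_].
by rewrite mulr0 rmorph0 !mulr0.
Qed.

Lemma res_mx_compat x c : res_row x * res_mx x c * res_col c = res_mx x c.
Proof.
case: x c => [l' j] [[[l i] a]|] /=; rewrite /res_row /=; last first.
  by case: ifP; rewrite mulr1 ?evt_idem ?mulr0.
case: (boolP (arrow_at a i)) => [/andP[aD /eqP vi]|]; last by rewrite mulr0.
case: ifP => _; last by rewrite mulr0 mul0r.
rewrite mulrBr mulrBl; apply: (f_equal2 (fun x y : A => x - y)).
  by rewrite !mulrA ksc_rho_target -!mulrA evt_idem !mulrA -kscal_comm -!mulrA evt_idem.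
by case: eqP => [<-|_]; rewrite ?mulr0 ?mul0r // vi evt_arr arr_evt.
Qed.

Lemma res_pmap_valid : valid_pmap res_pmap.
Proof. apply: diag_pmap_valid; [exact: res_col_idem|exact: res_row_idem|exact: res_mx_compat]. Qed.

Section Target.
Variables (S : pzRingType) (g : {rmorphism A -> S}).

Lemma sum_res_mx_None (y : 'I_N * 'I_N -> S) : (forall x, y x * g (res_row x) = y x) ->
  \sum_x y x * g (res_mx x None) = \sum_l y (l, l).
Proof.
move=> yE; rewrite big_pair /=.
apply: eq_bigr => l _; rewrite (bigD1 l) //= eqxx big1 => [|i /negPf il].
  by rewrite addr0; apply: (yE (l, l)).
by rewrite eq_sym il rmorph0 mulr0.
Qed.

(** The vanishing of these components says that the map sending [E_li] to [y (l, i)] respects right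
    multiplication by the arrows. *)
Lemma sum_res_mx_Some (y : 'I_N * 'I_N -> S) l i a : (forall x, y x * g (res_row x) = y x) ->
  \sum_x y x * g (res_mx x (Some (l, i, a))) =
  if arrow_at a i then \sum_j y (l, j) * g (ksc (rho (arr a) i j)) - y (l, i) * g (arr a) else 0.
Proof.
move=> yE.
rewrite big_pair /=.
case: (boolP (arrow_at a i)) => _ /=; last first.
  by apply: big1 => l' _; apply: big1 => j _; rewrite rmorph0 mulr0.
rewrite (bigD1 l) //= [X in _ + X]big1 => [|l' /negPf ll]; last first.
  by apply: big1 => j _; rewrite ll rmorph0 mulr0.
rewrite addr0 eqxx; under eq_bigr do rewrite rmorphB mulrBr.
rewrite sumrB; congr (_ - _).
  apply: eq_bigr => j _; rewrite kscal_comm -ksc_rho_target rmorphM mulrA.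
  by congr (_ * _); apply: (yE (l, j)).
rewrite (bigD1 i) //= eqxx big1 ?addr0 // => j /negPf ji.
by rewrite eq_sym ji rmorph0 mulr0.
Qed.

Hypothesis ginv : inverts_pmap g res_pmap.

(** The values of [psi] on matrix units form a row whose [Some] components vanish by linearity and
    whose [None] component is [psi 1]; injectivity of the induced map kills it. *)
Lemma rho_linear_eq0 (psi : {additive 'M[k]_N -> S}) :
  (forall M x, psi (M *m rho x) = psi M * g x) -> psi 1%:M = 0 -> forall M, psi M = 0.
Proof.
move=> psiA psi1.
have [_ inj] := (inverts_diag_pmapP res_col_idem res_row_idem res_mx_compat g).1 ginv.
have psiC M c : psi M * g (ksc c) = psi (c *: M) by rewrite -psiA rhoC mul_mx_scalar.
pose y (x : 'I_N * 'I_N) := psi (delta_mx x.1 x.2).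
have yE x : y x * g (res_row x) = y x.
  rewrite /y -psiA rhoV mul_mx_diag; congr (psi _); apply/matrixP=> i j; rewrite !mxE.
  by have [->|_] := eqVneq j x.2; rewrite ?eqxx ?mulr1 ?andbF ?mul0r.
have y0 x : y x = 0.
  apply: inj => // -[[[l i] a]|]; last first.
    rewrite sum_res_mx_None // -raddf_sum -[RHS]psi1; congr (psi _).
    by rewrite mx1_sum_delta.
  rewrite sum_res_mx_Some //; case: ifP => // _.
  under eq_bigr do rewrite psiC.
  by rewrite -raddf_sum -psiA mul_delta_mxE subrr.
move=> M; rewrite [M]matrix_sum_delta raddf_sum big1 // => i _.
rewrite raddf_sum big1 // => j _.
by rewrite -psiC -[psi _]/(y (i, j)) y0 mul0r.
Qed.

(** The difference of two factorisations is [A]-linear and vanishes at [1]. *)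
Lemma rho_factor_unique (h h' : {rmorphism 'M[k]_N -> S}) :
  (forall x, g x = h (rho x)) -> (forall x, g x = h' (rho x)) -> h' =1 h.
Proof.
move=> hE h'E.
have psiB : zmod_morphism (fun M => h' M - h M).
  by move=> M M' /=; rewrite !rmorphB !opprB addrACA [RHS]addrACA [- _ - _]addrC.
pose psi := additive_pack psiB.
have psiA M x : psi (M *m rho x) = psi M * g x.
  by rewrite /psi /= mulmxE !rmorphM -h'E -hE mulrBl.
have psi1 : psi 1%:M = 0 by rewrite /psi /= idmxE !rmorph1 subrr.
by move=> M; apply/eqP; rewrite -subr_eq0; apply/eqP; apply: (rho_linear_eq0 psiA psi1).
Qed.

(* Invertibility at [res_pmap] provides the [A]-linear map [h : T -> S] with
   [h 1 = 1]; its multiplicativity follows from [rho_linear_eq0]. *)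
Lemma rho_factor : exists h : {rmorphism 'M[k]_N -> S}, forall x, g x = h (rho x).
Proof.
have [surj _] := (inverts_diag_pmapP res_col_idem res_row_idem res_mx_compat g).1 ginv.
(* The zeros encode linearity over the arrows and the entry [1] encodes [h 1 = 1]. *)
have [|y yE ys] := surj (fun c => if c is None then 1 else 0).
  by case=> [[[l i] a]|]; rewrite ?mul0r // mul1r rmorph1.
have y1 : \sum_l y (l, l) = 1 by rewrite -(sum_res_mx_None yE) ys.
have ya l i a : y (l, i) * g (arr a) = \sum_j y (l, j) * g (ksc (rho (arr a) i j)).
  have := ys (Some (l, i, a)); rewrite sum_res_mx_Some //.
  case: (boolP (arrow_at a i)) => [_ /eqP|ai _]; first by rewrite subr_eq0 => /eqP.
  rewrite big1 => [|j _]; last by rewrite rho_arr_notat // !rmorph0 mulr0.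
  move: ai; rewrite negb_and => /orP[/arr_notin->|/negPf vi]; first by rewrite rmorph0 mulr0.
  rewrite -[y _]yE -mulrA -rmorphM -evt_arr mulrA /res_row /= evtx_mul vi.
  by rewrite mul0r rmorph0 mulr0.
pose h (M : 'M[k]_N) : S := \sum_l \sum_i y (l, i) * g (ksc (M l i)).
have hB : zmod_morphism h.
  move=> M M'; rewrite /h -sumrB; apply: eq_bigr => l _; rewrite -sumrB; apply: eq_bigr => i _.
  by rewrite !mxE !rmorphB mulrBr.
have h1 : h 1%:M = 1.
  rewrite /h -[RHS]y1; apply: eq_bigr => l _; rewrite (bigD1 l) //= big1 => [|i /negPf il].
    by rewrite mxE eqxx !rmorph1 mulr1 addr0.
  by rewrite mxE eq_sym il !rmorph0 mulr0.
have hA M x : h (M *m rho x) = h M * g x.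
  elim/pathalg_ind: x M => [x x' IH IH'|x x' IH IH'|c|v|a aD] M.
  - by rewrite !rmorphD /= mulmxDr mulrDr -IH -IH'; apply: (raddfD (additive_pack hB)).
  - by rewrite !rmorphM /= -mulmxE mulmxA IH' IH mulrA.
  - rewrite rhoC mul_mx_scalar /h mulr_suml; apply: eq_bigr => l _.
    rewrite mulr_suml; apply: eq_bigr => i _; rewrite mxE -mulrA -rmorphM.
    by rewrite -kscal_comm -rmorphM.
  - rewrite rhoV mul_mx_diag /h mulr_suml; apply: eq_bigr => l _.
    rewrite mulr_suml; apply: eq_bigr => i _.
    rewrite !mxE -[RHS]mulrA -(rmorphM g) kscal_comm (rmorphM g) [RHS]mulrA.
    have -> : y (l, i) * g (evt v) = if vb i == v then y (l, i) else 0.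
      rewrite -[in LHS]yE -mulrA -rmorphM evtx_mul.
      by case: ifP => _; [exact: (yE (l, i))|rewrite rmorph0 mulr0].
    by case: eqP => _; rewrite ?mulr1 // mulr0 !rmorph0 mulr0 mul0r.
  rewrite -(arrE aD) /h mulr_suml; apply: eq_bigr => l _.
  under eq_bigr do rewrite mxE !rmorph_sum mulr_sumr.
  rewrite exchange_big mulr_suml /=; apply: eq_bigr => i _.
  rewrite -mulrA -rmorphM kscal_comm rmorphM mulrA ya mulr_suml.
  by apply: eq_bigr => j _; rewrite -mulrA -rmorphM -kscal_comm -rmorphM.
have hM : monoid_morphism h.
  split=> // M M'; apply/eqP; rewrite -subr_eq0; apply/eqP.
  (* For fixed [M] the defect of multiplicativity is [A]-linear in [M'] and vanishes at [M' = 1]. *)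
  have psiB : zmod_morphism (fun M' => h (M * M') - h M * h M').
    by move=> M1 M2 /=; rewrite mulrBr !hB mulrBr !opprB addrACA [RHS]addrACA [- _ - _]addrC.
  pose psi := additive_pack psiB; rewrite -[LHS]/(psi M').
  apply: rho_linear_eq0 => [M1 x|]; rewrite /psi /=.
    by rewrite -[M * (_ *m _)]/(M *m (_ *m _)) mulmxA !hA mulrA mulrBl.
  by rewrite idmxE mulr1 -idmxE h1 mulr1 subrr.
exists (rmorphism_pack hB hM) => x /=.
by rewrite -[rho x]mul1mx hA h1 mul1r.
Qed.

End Target.

(* The block lower triangular representation with lower left corner [xi a] at
   the arrow [a] is an extension of [rho] by itself; a splitting of it
   exhibits the cocycle [xi] as a coboundary. *)
Lemma ext1_coboundary (xi : E -> 'M[k]_N) :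
  ext1_vanishes rho ->
  (forall a i j, xi a i j = (vb i == s a)%:R * xi a i j * (vb j == t a)%:R) ->
  exists phi : 'M[k]_N, (forall v, phi *m rho (evt v) = rho (evt v) *m phi) /\
    forall a, a \in D -> rho (arr a) *m phi - phi *m rho (arr a) = xi a.
Proof.
move=> ext xiE.
have scal_zmod : zmod_morphism (fun c : k => c%:M : 'M[k]_(N + N)) by exact: raddfB.
have scal_mon : monoid_morphism (fun c : k => c%:M : 'M[k]_(N + N)).
  by split=> // c c'; rewrite scalar_mxM.
pose c := rmorphism_pack scal_zmod scal_mon.
pose eps v : 'M[k]_(N + N) := block_mx (rho (evt v)) 0 0 (rho (evt v)).
pose phi a : 'M[k]_(N + N) := block_mx (rho (arr a)) 0 (xi a) (rho (arr a)).
have [|||||rX [rXC rXV rXA]] := @pathalg_lift k m E s t D 'M[k]_(N + N) c eps phi.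
- by move=> x v; rewrite /GRing.comm /= -!mulmxE scalar_mxC.
- by move=> x a; rewrite /GRing.comm /= -!mulmxE scalar_mxC.
- move=> v u; rewrite -mulmxE mulmx_block !mulmx0 !mul0mx !addr0 !add0r.
  rewrite mulmxE -rmorphM evtx_mul; case: eqP => // _.
  by rewrite rmorph0 block_mx0.
- rewrite /eps; have -> : 1 = block_mx (rho 1) 0 0 (rho 1) :> 'M[k]_(N + N).
    by rewrite rmorph1 -idmxE -scalar_mx_block.
  rewrite -(evtx_sum k s t D) rmorph_sum /=.
  elim/big_rec2: _ => [|v M1 M2 _ ->]; first by rewrite block_mx0.
  by rewrite add_block_mx !addr0.
- move=> a aD; rewrite /eps /phi -!mulmxE !mulmx_block !mulmx0 !mul0mx !addr0 !add0r.
  rewrite !mulmxE -!rmorphM evt_arr arr_evt -!mulmxE !rhoV mul_diag_mx mul_mx_diag.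
  split; congr block_mx; apply/matrixP=> i j; rewrite !mxE xiE.
    by case: (vb i == _); rewrite ?mul0r ?mul1r.
  by case: (vb j == _); rewrite ?mulr0 ?mulr1.
have rXE x : [/\ ulsubmx (rX x) = rho x, ursubmx (rX x) = 0 & drsubmx (rX x) = rho x].
  elim/pathalg_ind: x => [x y [x1 x2 x3] [y1 y2 y3]|x y [x1 x2 x3] [y1 y2 y3]|x|v|a aD].
  - rewrite !rmorphD /= -[rX x]submxK -[rX y]submxK x1 x2 x3 y1 y2 y3 add_block_mx.
    by rewrite block_mxKul block_mxKur block_mxKdr addr0.
  - rewrite !rmorphM /= -mulmxE -[rX x]submxK -[rX y]submxK x1 x2 x3 y1 y2 y3 mulmx_block.
    by rewrite block_mxKul block_mxKur block_mxKdr !mulmx0 !mul0mx !addr0 !add0r.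
  - rewrite rXC rhoC /c /= scalar_mx_block.
    by rewrite block_mxKul block_mxKur block_mxKdr.
  - by rewrite rXV block_mxKul block_mxKur block_mxKdr.
  by rewrite rXA block_mxKul block_mxKur block_mxKdr -(arrE aD).
have [S [SA S1]] := ext rX rXC rXE.
(* A section of the projection has identity right half; its left half is the required [phi], as the
   left blocks of [SA] show. *)
have SE : S = row_mx (lsubmx S) 1%:M.
  rewrite -{1}[S]hsubmxK; congr row_mx; move: S1.
  by rewrite -{1}[S]hsubmxK mul_row_col mulmx0 add0r mulmx1.
exists (lsubmx S); split=> [v|a aD].
  have := SA (evt v); rewrite SE rXV mul_row_block mul_mx_row => /eq_row_mx[].
  by rewrite mulmx0 addr0 -SE.
have := SA (arr a); rewrite SE (arrE aD) rXA /phi mul_row_block mul_mx_row => /eq_row_mx[].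
by rewrite -SE mul1mx (arrE aD) => <- _; rewrite addrC addKr.
Qed.

(** Fix [l] and a row index [r] of the target. The entries [y (l, i) r j], for varying [i] and [j],
    form one matrix [Phi l r], and the [Some] components of the image of [y] are the coboundary
    [rho a *m Phi - Phi *m rho a] of that matrix. *)
Lemma rho_inverts : exceptional rho -> inverts_pmap rho res_pmap.
Proof.
move=> [[_ brick_rho] ext].
apply/(inverts_diag_pmapP res_col_idem res_row_idem res_mx_compat rho).
have yrE (y : 'I_N * 'I_N -> 'M[k]_N) :
    (forall x, y x * rho (res_row x) = y x) <->
    (forall x r j, y x r j = y x r j * (vb j == vb x.2)%:R).
  split=> yE x => [r j|].
    by rewrite -{1}[y x]yE /res_row rhoV -mulmxE mul_mx_diag !mxE.
  by rewrite /res_row rhoV -mulmxE mul_mx_diag; apply/matrixP=> r j; rewrite !mxE -yE.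
split=> [z zE|y yE ys].
  pose xi l r a : 'M[k]_N := \matrix_(i, j) z (Some (l, i, a)) r j.
  have xiE l r a i j : xi l r a i j = (vb i == s a)%:R * xi l r a i j * (vb j == t a)%:R.
    rewrite mxE -zE /=; case: (boolP (arrow_at a i)) => [/andP[_ ->]|_].
      rewrite mul1r rhoV -mulmxE mul_mx_diag !mxE -mulrA -natrM mulnb andbb //.
    by rewrite rmorph0 mulr0 mxE mulr0 mul0r.
  have /fin_all_exists[Phi PhiP] (lr : 'I_N * 'I_N) := ext1_coboundary ext (xiE lr.1 lr.2).
  pose y0 (x : 'I_N * 'I_N) : 'M[k]_N := \matrix_(r, j) Phi (x.1, r) x.2 j.
  (* [y0] already has the right [Some] components. Adding the family [w E_li] leaves them unchanged,
     because the matrix units satisfy the linearity relations, and shifts the [None] component by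
     [w]. *)
  pose w := z None - \sum_l y0 (l, l).
  pose y x := y0 x + w *m delta_mx x.1 x.2.
  have y0E x : y0 x * rho (res_row x) = y0 x.
    apply/yrE: x => x r j; rewrite !mxE.
    have [/(_ (vb x.2))/matrixP/(_ x.2 j)] := PhiP (x.1, r).
    by rewrite !rhoV mul_diag_mx mul_mx_diag !mxE eqxx mul1r => ->.
  have wE x : w *m delta_mx x.1 x.2 * rho (res_row x) = w *m delta_mx x.1 x.2.
    rewrite -mulmxE -mulmxA; congr (_ *m _); rewrite rhoV mul_mx_diag.
    apply/matrixP=> i j; rewrite !mxE.
    by have [->|_] := eqVneq j x.2; rewrite ?eqxx ?mulr1 ?andbF ?mul0r.
  have yE x : y x * rho (res_row x) = y x by rewrite mulrDl y0E wE.
  exists y => // -[[[l i] a]|]; last first.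
    rewrite sum_res_mx_None // big_split /= -mulmx_sumr -mx1_sum_delta mulmx1.
    by rewrite addrC subrK.
  rewrite sum_res_mx_Some //; case: (boolP (arrow_at a i)) => [/andP[aD vi]|ai]; last first.
    by rewrite -zE /= (negPf ai) rmorph0 mulr0.
  have wa : \sum_j w *m delta_mx l j * rho (ksc (rho (arr a) i j)) =
      w *m delta_mx l i * rho (arr a).
    rewrite -[RHS]/(_ *m _ *m _) -mulmxA mul_delta_mxE mulmx_sumr; apply: eq_bigr => j _.
    by rewrite rhoC -mulmxE mul_mx_scalar scalemxAr.
  under eq_bigr do rewrite mulrDl.
  rewrite big_split /= wa [y (l, i) * _]mulrDl opprD addrACA subrr addr0.
  apply/matrixP=> r q; have [_ /(_ a aD)/matrixP/(_ i q)] := PhiP (l, r).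
  rewrite !mxE summxE => <-; congr (_ - _); apply: eq_bigr => j _.
    by rewrite rhoC -mulmxE mul_mx_scalar !mxE.
  by rewrite !mxE.
pose Phi l r : 'M[k]_N := \matrix_(i, j) y (l, i) r j.
have Phi_comm l r x : Phi l r *m rho x = rho x *m Phi l r.
  elim/pathalg_ind: x => [x x' IH IH'|x x' IH IH'|c|v|a aD].
  - by rewrite rmorphD /= mulmxDl mulmxDr IH IH'.
  - by rewrite rmorphM /= -mulmxE mulmxA IH -mulmxA IH' mulmxA.
  - by rewrite rhoC scalar_mxC.
  - rewrite rhoV mul_diag_mx mul_mx_diag; apply/matrixP=> i j; rewrite !mxE.
    rewrite ((yrE y).1 yE) /=; have [->|_] := eqVneq (vb j) (vb i); first by rewrite mulrC.
    by rewrite mulr0 mul0r mulr0.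
  rewrite -(arrE aD); apply/matrixP=> i q.
  have := ys (Some (l, i, a)); rewrite sum_res_mx_Some //.
  case: (boolP (arrow_at a i)) => [_ /eqP|ai _].
    rewrite subr_eq0 => /eqP/matrixP/(_ r q); rewrite summxE !mxE => e.
    rewrite [RHS](_ : _ = \sum_j (y (l, j) * rho (ksc (rho (arr a) i j))) r q).
      by rewrite e; apply: eq_bigr => j _; rewrite mxE.
    by apply: eq_bigr => j _; rewrite rhoC -mulmxE mul_mx_scalar !mxE.
  rewrite !mxE big1 => [|j _].
    by rewrite big1 // => j _; rewrite rho_arr_notat ?mul0r.
  rewrite mxE ((yrE y).1 yE) /=; have [vj|_] := eqVneq (vb j) (vb i); last by rewrite mulr0 mul0r.
  by rewrite rho_arr_notat ?mulr0 // /arrow_at vj.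
have /fin_all_exists[c cE] (lr : 'I_N * 'I_N) : exists c : k, Phi lr.1 lr.2 = c%:M.
  exact: brick_rho (Phi_comm _ _).
(* Entry [(r, l)] of the [None] equation is the sum over [j] of [Phi j r] at [(j, l)]; these
   matrices being scalar, only [c (l, r)] survives. *)
have c0 l r : c (l, r) = 0.
  have := ys None; rewrite sum_res_mx_None // => /matrixP/(_ r l).
  rewrite summxE mxE (bigD1 l) //= big1 => [|j /negPf jl].
    by have /matrixP/(_ l l) := cE (l, r); rewrite !mxE eqxx addr0 => ->.
  by have /matrixP/(_ j l) := cE (j, r); rewrite !mxE jl => ->.
case=> l i; apply/matrixP=> r j.
by have /matrixP/(_ i j) := cE (l, r); rewrite c0 !mxE mul0rn.
Qed.
End Resolution.

(** * The inclusion of [kQ] in [kQ'] as a ring morphism *)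

Section Inclusion.
Variables (k : fieldType) (m : nat) (E : finType) (s t : E -> 'I_m) (D : pred E).
Local Notation A := (pathalg k m E s t D).
Local Notation A' := (pathalg k m E s t predT).

Lemma incl_zmod_morphism : zmod_morphism (@incl k m E s t D).
Proof.
move=> x y; apply: pa_val_inj.
by rewrite -[LHS]/(pa_val (x - y)) !pa_valD !pa_valN.
Qed.

Lemma incl_monoid_morphism : monoid_morphism (@incl k m E s t D).
Proof.
split=> [|x y]; apply: pa_val_inj; first by rewrite -[LHS]/(pa_val (1 : A)) !pa_val1.
by rewrite -[LHS]/(pa_val (x * y)) !pa_valM.
Qed.

HB.instance Definition _ :=
  GRing.isZmodMorphism.Build A A' (@incl k m E s t D) incl_zmod_morphism.
HB.instance Definition _ :=
  GRing.isMonoidMorphism.Build A A' (@incl k m E s t D) incl_monoid_morphism.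

Lemma incl_kscal (c : k) : incl (kscal s t D c) = kscal s t predT c.
Proof. exact: pa_val_inj. Qed.

Lemma incl_evtx v : incl (evtx k s t D v) = evtx k s t predT v.
Proof. exact: pa_val_inj. Qed.

Lemma incl_arr a : a \in D -> incl (arr k s t D a) = arr k s t predT a.
Proof.
move=> aD; rewrite (arrE _ _ _ aD) (arrE _ _ _ (isT : a \in predT)).
exact: pa_val_inj.
Qed.

End Inclusion.

(** * Morphisms out of a matrix ring over a free algebra *)

Section MatrixLift.
Variables (k : fieldType) (I : choiceType) (N : nat) (S : pzRingType).
Variables (h : {rmorphism 'M[k]_N -> S}) (F : {rmorphism FreeAlg k I -> S}).
Hypothesis FC : forall c, F c%:MP = h c%:M.
Local Notation U i j := (h (delta_mx i j)).
Hypothesis FU : forall i a b, F << fmu i >> * U a b = U a b * F << fmu i >>.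

Lemma mul_munit a b c d : U a b * U c d = if b == c then U a d else 0.
Proof.
rewrite -rmorphM /= -mulmxE mul_delta_mx_cond.
by case: eqP => _; rewrite ?mulr1n // mulr0n rmorph0.
Qed.

Lemma sum_munit : \sum_i U i i = 1.
Proof. by rewrite -rmorph_sum -mx1_sum_delta idmxE rmorph1. Qed.

Lemma munit_comm x a b : F x * U a b = U a b * F x.
Proof.
elim/FreeAlg_ind: x => [x y Hx Hy|x y Hx Hy|c|//].
- by rewrite rmorphD mulrDl mulrDr Hx Hy.
- by rewrite rmorphM mulrA -Hx -mulrA Hy mulrA.
by rewrite FC -!rmorphM /= -!mulmxE scalar_mxC.
Qed.

Lemma mul_munit_terms x y a b c d : (F x * U a b) * (F y * U c d) = F (x * y) * (U a b * U c d).
Proof. by rewrite rmorphM -!mulrA [U a b * (_ * _)]mulrA -munit_comm -!mulrA. Qed.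

(** The [h (delta_mx i j)] are matrix units of [S]. The image of [F] lies in their centraliser,
    which needs checking only on the variables, so coefficients can be collected in front of
    products of units. *)
Lemma matrix_lift : exists H : {rmorphism 'M[FreeAlg k I]_N -> S},
  forall M, H M = \sum_i \sum_j F (M i j) * U i j.
Proof.
pose H (M : 'M[FreeAlg k I]_N) : S := \sum_i \sum_j F (M i j) * U i j.
have HB : zmod_morphism H.
  move=> M M'; rewrite /H -sumrB; apply: eq_bigr => i _; rewrite -sumrB; apply: eq_bigr => j _.
  by rewrite !mxE rmorphB mulrBl.
have HM : monoid_morphism H.
  split=> [|M M'].
    rewrite /H -[RHS]sum_munit; apply: eq_bigr => i _.
    rewrite (bigD1 i) //= big1 => [|j /negPf ji]; last by rewrite mxE eq_sym ji rmorph0 mul0r.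
    by rewrite mxE eqxx rmorph1 mul1r addr0.
  rewrite /H mulr_suml; apply: eq_bigr => i _.
  under eq_bigr do rewrite mxE rmorph_sum mulr_suml.
  rewrite exchange_big mulr_suml; apply: eq_bigr => l _.
  rewrite mulr_sumr [RHS](bigD1 l) //= [X in _ + X]big1 ?addr0 => [|l' /negPf ll]; last first.
    rewrite mulr_sumr big1 // => j _.
    by rewrite mul_munit_terms mul_munit eq_sym ll mulr0.
  rewrite mulr_sumr; apply: eq_bigr => j _.
  by rewrite mul_munit_terms mul_munit eqxx.
by exists (rmorphism_pack HB HM).
Qed.

End MatrixLift.

(** * The extension of [rho] to [kQ'] and its universal property *)

Section Extension.
Variables (k : fieldType) (m : nat) (E : finType) (s t : E -> 'I_m) (D : pred E) (N : nat).
Local Notation A := (pathalg k m E s t D).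
Local Notation A' := (pathalg k m E s t predT).
Variables (rho : {rmorphism A -> 'M[k]_N}) (vb : 'I_N -> 'I_m).
Hypothesis rhoC : klinear rho.
Hypothesis rhoV : forall v, rho (evtx k s t D v) = diag_mx (\row_i (vb i == v)%:R).
Hypothesis exc : exceptional rho.

(* [(e, i, j)] is the variable in position [(i, j)] of the image of the new arrow [e] *)
Definition newvar : {set E * 'I_N * 'I_N} :=
  [set q | [&& q.1.1 \notin D, vb q.1.2 == s q.1.1 & vb q.2 == t q.1.1]].

Local Notation FA := (FreeAlg k 'I_#|newvar|).
Local Notation var := (enum_val : 'I_#|newvar| -> E * 'I_N * 'I_N).

(** The generic matrix supported on the block from [s e] to [t e]. *)
Definition newarrow (e : E) : 'M[FA]_N :=
  \sum_(q | (var q).1.1 == e) (<< fmu q >> : FA) *: delta_mx (var q).1.2 (var q).2.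

Lemma var_in q : [/\ (var q).1.1 \notin D, vb (var q).1.2 = s (var q).1.1
  & vb (var q).2 = t (var q).1.1].
Proof. by have := enum_valP q; rewrite inE => /and3P[-> /eqP-> /eqP->]. Qed.

Local Notation iota := (map_mx (fun c : k => c%:MP : FA)).

Lemma iota_zmod_morphism : zmod_morphism (iota : 'M[k]_N -> 'M[FA]_N).
Proof. by move=> M M'; apply: (map_mxB (@mkmalgU _ k mone)). Qed.

Lemma iota_monoid_morphism : monoid_morphism (iota : 'M[k]_N -> 'M[FA]_N).
Proof.
split=> [|M M']; first exact: (map_mx1 (@mkmalgU {fmonom _} k mone)).
exact: (map_mxM (@mkmalgU {fmonom _} k mone)).
Qed.

Definition iota_mx := rmorphism_pack iota_zmod_morphism iota_monoid_morphism.

Lemma newarrow_var q : newarrow (var q).1.1 (var q).1.2 (var q).2 = << fmu q >>.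
Proof.
rewrite /newarrow summxE (bigD1 q) ?eqxx // big1 => [|q' /andP[/eqP e /negPf q'q]].
  by rewrite [LHS]addr0 scale_delta_mxE !eqxx.
rewrite scale_delta_mxE; case: ifP => // /andP[/eqP e1 /eqP e2].
suff /enum_val_inj q'E : var q' = var q by rewrite q'E eqxx in q'q.
case: (var q') (var q) e e1 e2 => [[e' i'] j'] [[e'' i''] j''] /=.
by move=> -> <- <-.
Qed.

(** Recovers each variable from matrix units and the image of a new arrow, so any factorisation is
    determined on variables; the same formula dictates its value in a test ring. *)
Lemma var_newarrow q : (<< fmu q >> : FA)%:M =
  \sum_l delta_mx l (var q).1.2 *m newarrow (var q).1.1 *m delta_mx (var q).2 l :> 'M[FA]_N.
Proof.
under eq_bigr do rewrite delta_mx_sandwich newarrow_var.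
by rewrite -scaler_sumr -mx1_sum_delta scalemx1.
Qed.

Lemma iota_diag v : iota_mx (rho (evtx k s t D v)) = diag_mx (\row_i (vb i == v)%:R).
Proof.
rewrite rhoV /= map_diag_mx; congr diag_mx; apply/rowP=> i; rewrite !mxE.
exact: rmorph_nat.
Qed.

Lemma newarrow_source e : iota_mx (rho (evtx k s t D (s e))) *m newarrow e = newarrow e.
Proof.
rewrite iota_diag /newarrow mulmx_sumr; apply: eq_bigr => q /eqP <-.
by apply: mul_diag_scale_delta; have [_ -> _] := var_in q.
Qed.

Lemma newarrow_target e : newarrow e *m iota_mx (rho (evtx k s t D (t e))) = newarrow e.
Proof.
rewrite iota_diag /newarrow mulmx_suml; apply: eq_bigr => q /eqP <-.
by apply: mul_scale_delta_diag; have [_ _ ->] := var_in q.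
Qed.

Lemma extension_exists : exists f : {rmorphism A' -> 'M[FA]_N},
  [/\ forall x : A, f (incl x) = iota_mx (rho x) &
      forall e, e \notin D -> f (arr k s t predT e) = newarrow e].
Proof.
have cB : zmod_morphism (fun c : k => iota_mx c%:M) by move=> x y; rewrite !raddfB.
have cM : monoid_morphism (fun c : k => iota_mx c%:M).
  split=> [|x y]; first by rewrite idmxE rmorph1.
  by rewrite scalar_mxM mulmxE rmorphM.
have c_central x (M : 'M[FA]_N) : iota_mx x%:M * M = M * iota_mx x%:M.
  rewrite /= map_scalar_mx -!mulmxE.
  exact/scalar_mx_central/malgC_comm.
pose phi e := if e \in D then iota_mx (rho (arr k s t D e)) else newarrow e.
have [|||||f [fC fV fA]] := @pathalg_lift k m E s t predT 'M[FA]_N (rmorphism_pack cB cM)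
  (fun v => iota_mx (rho (evtx k s t D v))) phi.
- by move=> x v; apply: c_central.
- by move=> x e; apply: c_central.
- move=> v u; rewrite -!rmorphM evtx_mul; case: eqP => // _.
  by rewrite !rmorph0.
- by rewrite -!rmorph_sum evtx_sum !rmorph1.
- move=> e _; rewrite /phi; case: ifP => eD; first by rewrite -!rmorphM evt_arr arr_evt.
  by rewrite -mulmxE newarrow_source newarrow_target.
exists f; split=> [x|e /negPf eD]; last first.
  by rewrite (arrE _ _ _ (isT : e \in predT)) fA /phi eD.
apply: (@eq_pathalg_morphism k m E s t D _ (f \o @incl k m E s t D) (iota_mx \o rho)) x
  => [x|v|e eD] /=.
- by rewrite incl_kscal fC rhoC.
- by rewrite incl_evtx fV.
by rewrite -(arrE _ _ _ eD) incl_arr // (arrE _ _ _ (isT : e \in predT)) fA /phi eD.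
Qed.

(** The localised map is the base change to [kQ'] of the one defining [rho]: a morphism inverts it
    exactly when its restriction to [kQ] inverts the original. *)
Lemma extension_is_universal_localisation (f : {rmorphism A' -> 'M[FA]_N}) :
  (forall x : A, f (incl x) = iota_mx (rho x)) ->
  (forall e, e \notin D -> f (arr k s t predT e) = newarrow e) ->
  is_universal_localisation f.
Proof.
move=> f_incl f_new.
exists (eq (map_pmap (@incl k m E s t D) (res_pmap rho vb))); split.
  by move=> _ <-; apply/map_pmap_valid/res_pmap_valid.
split=> [_ <-|S g /(_ _ erefl)/inverts_map_pmap ginv].
  apply/inverts_map_pmap; apply: eq_inverts_pmap (fun x => esym (f_incl x)) _.
  exact/inverts_pmap_comp/rho_inverts.
pose g0 : {rmorphism A -> S} := g \o @incl k m E s t D.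
have [h hE] : exists h : {rmorphism 'M[k]_N -> S}, forall x, g0 x = h (rho x) by exact: rho_factor.
have gC c : g (kscal s t predT c) = h c%:M by rewrite -rhoC -hE /= incl_kscal.
have gV v : g (evtx k s t predT v) = h (rho (evtx k s t D v)) by rewrite -hE /= incl_evtx.
pose U i j := h (delta_mx i j).
have UM a b c d : U a b * U c d = if b == c then U a d else 0 by exact: mul_munit.
have U1 : \sum_i U i i = 1 by exact: sum_munit.
(* The [(i, j)] coefficient of the image of the new arrow with respect to the units [U]. Summing
   over [l] places it in their centraliser. *)
pose z q := \sum_l U l (var q).1.2 * g (arr k s t predT (var q).1.1) * U (var q).2 l.
have [|F [FC Fz]] := @FreeAlg_lift k 'I_#|newvar| S (g \o kscal s t predT) z.
  move=> c q; rewrite /GRing.comm /= /z mulr_sumr mulr_suml; apply: eq_bigr => l _.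
  have cU a b : h c%:M * U a b = U a b * h c%:M by rewrite -!rmorphM -!mulmxE scalar_mxC.
  rewrite gC; apply: commrM; last exact: cU.
  apply: commrM; first exact: cU.
  by rewrite /GRing.comm -gC -!rmorphM kscal_comm.
have {}FC c : F c%:MP = h c%:M by rewrite FC /= gC.
have zU q a b : F << fmu q >> * U a b = U a b * F << fmu q >>.
  rewrite Fz /z mulr_suml mulr_sumr (bigD1 a) //= [RHS](bigD1 b) //= !big1 ?addr0.
  - by rewrite -mulrA UM eqxx !mulrA UM eqxx.
  - by move=> l /negPf lb; rewrite !mulrA UM eq_sym lb !mul0r.
  by move=> l /negPf la; rewrite -mulrA UM la mulr0.
have [H HE] := matrix_lift FC zU.
have Hiota M : H (iota_mx M) = h M.
  rewrite HE [in RHS](matrix_sum_delta M) rmorph_sum; apply: eq_bigr => i _.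
  rewrite rmorph_sum; apply: eq_bigr => j _.
  by rewrite mxE FC -rmorphM -mulmxE mul_scalar_mx.
have HZ x a b : H (x *: delta_mx a b) = F x * U a b.
  rewrite HE (bigD1 a) //= (bigD1 b) //= scale_delta_mxE !eqxx !big1 ?addr0 //.
    by move=> i /negPf ia; apply: big1 => j _; rewrite scale_delta_mxE ia rmorph0 mul0r.
  by move=> j /negPf jb; rewrite scale_delta_mxE jb andbF rmorph0 mul0r.
have rhoU v : h (rho (evtx k s t D v)) = \sum_(i | vb i == v) U i i.
  rewrite rhoV -rmorph_sum; congr (h _); apply/matrixP=> i j; rewrite !mxE summxE.
  have [vi|vi] := boolP (vb i == v); last first.
    rewrite big1 ?mul0rn // => l vl; rewrite mxE; case: eqP => // il.
    by rewrite il vl in vi.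
  rewrite (bigD1 i) //= mxE eqxx big1 ?addr0 => [|l /andP[_ /negPf li]]; last first.
    by rewrite mxE eq_sym li.
  by rewrite eq_sym; case: (_ == _).
have Hnew e : e \notin D -> H (newarrow e) = g (arr k s t predT e).
  move=> eD; rewrite /newarrow rmorph_sum /=.
  transitivity (\sum_(q | (var q).1.1 == e)
      U (var q).1.2 (var q).1.2 * g (arr k s t predT e) * U (var q).2 (var q).2).
    apply: eq_bigr => q /eqP <-; rewrite HZ Fz /z mulr_suml (bigD1 (var q).1.2) //=.
    rewrite -mulrA UM eqxx big1 ?addr0 // => l /negPf lq.
    by rewrite -mulrA UM lq mulr0.
  (* Both vertex idempotents around the arrow expand into diagonal units, so the right side becomes
     a sum over the positions of the block, that is, over the variables of [e]. *)
  rewrite -[in RHS]evt_arr -[in RHS]arr_evt !rmorphM !gV !rhoU.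
  rewrite -(big_enum_val_cond (fun q : E * 'I_N * 'I_N => q.1.1 == e)
    (fun q : E * 'I_N * 'I_N => U q.1.2 q.1.2 * g (arr k s t predT e) * U q.2 q.2)) /=.
  rewrite big_mkcond !big_pair (bigD1 e) //= [X in _ + X]big1 ?addr0 => [|e' /negPf ee]; last first.
    by apply: big1 => i _; apply: big1 => j _; rewrite ee andbF.
  rewrite mulrA !mulr_suml [RHS]big_mkcond; apply: eq_bigr => i _.
  case: (boolP (vb i == s e)) => vi; last first.
    by apply: big1 => j _; rewrite inE /= (negPf vi) andbF.
  rewrite mulr_sumr [RHS]big_mkcond; apply: eq_bigr => j _.
  by rewrite inE /= eD vi eqxx andbT.
have HfE x : g x = H (f x).
  apply: (@eq_pathalg_morphism k m E s t predT _ g (H \o f)) => [c|v|e eT] /=.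
  - by rewrite -(incl_kscal s t D) f_incl Hiota -hE.
  - by rewrite -(incl_evtx k s t D) f_incl Hiota -hE.
  rewrite -(arrE _ _ _ eT); have [eD|eD] := boolP (e \in D).
    by rewrite -(incl_arr k s t eD) f_incl Hiota -hE.
  by rewrite f_new // Hnew.
exists H; split=> // H' H'E.
(* On constant matrices, uniqueness reduces to that of the factorisation through [rho]. *)
have H'iota M : H' (iota_mx M) = h M.
  have H'E0 x : g0 x = (H' \o iota_mx) (rho x) by rewrite /= -f_incl -H'E.
  exact: (@rho_factor_unique k m E s t D N rho vb rhoC rhoV S g0 ginv h (H' \o iota_mx) hE H'E0 M).
have H'U a b : H' (delta_mx a b) = U a b.
  rewrite /U -H'iota /=; congr (H' _); apply/matrixP=> i j; rewrite !mxE.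
  by case: (_ && _); rewrite ?malgC0E.
have H'F x : H' x%:M = F x.
  elim/FreeAlg_ind: x => [x y Hx Hy|x y Hx Hy|c|q].
  - by rewrite !rmorphD /= Hx Hy.
  - by rewrite scalar_mxM mulmxE !rmorphM /= Hx Hy.
  - by rewrite FC -H'iota /= map_scalar_mx.
  rewrite var_newarrow rmorph_sum Fz; apply: eq_bigr => l _ /=.
  have [eD _ _] := var_in q.
  by rewrite !mulmxE !rmorphM /= !H'U -f_new // -H'E.
move=> M; rewrite HE [in LHS](matrix_sum_delta M) rmorph_sum; apply: eq_bigr => i _ /=.
rewrite rmorph_sum; apply: eq_bigr => j _ /=.
by rewrite -mul_scalar_mx mulmxE rmorphM /= H'F H'U.
Qed.

End Extension.

(** * The blocks of [alpha] and the number of new variables *)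

Section Blocks.
Variables (m : nat) (alpha : 'I_m -> nat).
Local Notation N := (dimsum alpha).
Local Notation in_block v i := (pre alpha v <= i < pre alpha v + alpha v)%N.

Lemma block_bound v : (pre alpha v + alpha v <= N)%N.
Proof.
rewrite /dimsum (bigID (fun u : 'I_m => (u < v)%N)) /= leq_add2l.
by rewrite (bigD1 v) ?ltnn //= leq_addr.
Qed.

Lemma card_block v : (\sum_(i < N | in_block v i) 1 = alpha v)%N.
Proof.
rewrite -(big_mkord (fun i => in_block v i) (fun=> 1%N)).
have := big_nat_widen 0 (pre alpha v + alpha v) N (leq (pre alpha v)) (fun=> 1%N) (block_bound v).
move=> /= <-; rewrite -(big_nat_widenl _ _ _ xpredT) //.
by rewrite sum_nat_const_nat muln1 addKn.
Qed.

Variables (k : fieldType) (E : finType) (s t : E -> 'I_m) (D : pred E).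
Variable rho : {rmorphism pathalg k m E s t D -> 'M[k]_N}.
Hypothesis rhoV : adapted rho.

(** That the blocks partition the indices is read off from [rho]: the vertex idempotents sum to [1],
    so each index lies in some block, and they are orthogonal, so it lies in only one. *)
Lemma adapted_vertex : exists vb : 'I_N -> 'I_m, forall i v, (vb i == v) = in_block v i.
Proof.
have blockM v u (i : 'I_N) :
    (blockE k alpha v *m blockE k alpha u) i i = (in_block v i && in_block u i)%:R.
  rewrite mxE (bigD1 i) //= big1 ?addr0 => [|j /negPf ji]; last by rewrite !mxE ji mulr0.
  by rewrite !mxE eqxx /= -natrM mulnb.
have ex i : exists v, in_block v (i : 'I_N).
  apply/existsP; apply: contraT; rewrite negb_exists => /forallP noblock.
  have /matrixP/(_ i i) : rho 1 = 1%:M by rewrite rmorph1.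
  rewrite -(evtx_sum k s t D) rmorph_sum summxE mxE eqxx big1 => [/eqP|v _].
    by rewrite eq_sym oner_eq0.
  by rewrite rhoV mxE (negPf (noblock v)) andbF.
have [vb vbP] := fin_all_exists ex.
exists vb => i v; apply/eqP/idP => [<-//|iv]; apply/eqP; apply: contraT => /negPf vv.
have := blockM (vb i) v i; rewrite -!rhoV mulmxE -rmorphM evtx_mul vv rmorph0 mxE iv vbP.
by move/eqP; rewrite eq_sym oner_eq0.
Qed.

End Blocks.

Lemma card_newvar (m : nat) (alpha : 'I_m -> nat) (E : finType) (s t : E -> 'I_m) (D : pred E)
    (vb : 'I_(dimsum alpha) -> 'I_m) :
  (forall i v, (vb i == v) = (pre alpha v <= i < pre alpha v + alpha v)%N) ->
  #|newvar s t D vb| = (\sum_(e : E | e \notin D) alpha (s e) * alpha (t e))%N.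
Proof.
move=> vbE.
have card_vb v : (\sum_(i | vb i == v) 1 = alpha v)%N.
  by rewrite -[RHS]card_block; apply: eq_bigl => i; rewrite vbE.
rewrite -sum1_card big_mkcond !big_pair [RHS]big_mkcond; apply: eq_bigr => e _.
case: ifP => eD; last by apply: big1 => i _; apply: big1 => j _; rewrite inE /= eD.
rewrite -(card_vb (s e)) -(card_vb (t e)) big_distrlr /= [RHS]big_mkcond.
apply: eq_bigr => i _; case: ifP => vi; last by apply: big1 => j _; rewrite inE /= vi andbF.
by rewrite [RHS]big_mkcond; apply: eq_bigr => j _; rewrite inE /= eD vi.
Qed.

(* Q' = (vertices 'I_m, arrows E, s, t), Q = (vertices 'I_m, arrows in D, s, t);
   B = k^N (row vectors) with right kQ-action b . a = b *m rho a in a basis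
   adapted to B = (+)_v B e_v, so rho = f_B : kQ -> End_k(B) = M_alpha(k). *)
Theorem theorem20 (k : closedFieldType) (m : nat) (E : finType) (s t : E -> 'I_m)
    (D : pred E) (alpha : 'I_m -> nat)
    (rho : {rmorphism pathalg k m E s t D -> 'M[k]_(dimsum alpha)}) :
  acyclic s t predT ->
  acyclic s t D ->
  klinear rho ->
  adapted rho ->
  exceptional rho ->
  let n := (\sum_(e : E | e \notin D) alpha (s e) * alpha (t e))%N in
  exists f' : {rmorphism pathalg k m E s t predT -> 'M[FreeAlg k 'I_n]_(dimsum alpha)},
    is_universal_localisation f' /\
    forall a : pathalg k m E s t D,
      f' (incl a) = map_mx (fun c : k => c%:MP) (rho a).
Proof.
move=> _ _ rhoC rhoV exc n; have [vb vbE] := adapted_vertex rhoV.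
(* After this rewriting the variables are enumerated by the positions in the blocks of the new
   arrows. *)
have -> : n = #|newvar s t D vb| by rewrite (card_newvar _ _ _ vbE).
have rhoD v : rho (evtx k s t D v) = diag_mx (\row_i (vb i == v)%:R).
  by rewrite rhoV; apply/matrixP=> i j; rewrite !mxE vbE mulrb; case: eqP.
have [f [f_incl f_new]] := extension_exists rhoC rhoD.
exists f; split; last exact: f_incl.
exact: (extension_is_universal_localisation rhoC rhoD exc f_incl f_new).
Qed.
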